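(* Let $A\in\mathcal{S}$ be such that $s(x;A)=f(x)+O(\epsilon(x))$ as $x\to+\infty$, where $f$ is $C^1$, $\epsilon(x)=o(f(x))$, and both $f$ and $\epsilon$ are type-1 functions. Let $\alpha>0$ be the least number such that $f$ and $\epsilon$ are defined on $[\alpha,+\infty)$. Then for every integer $d\geqslant 2$, $$ s_d(x;A)=\int_{\alpha}^{x-\alpha} s_{d-1}(t;A)\,f'(x-t)\,dt + O\big(f(x)^{d-1}\epsilon(x)\big) \quad (x\to+\infty).$$
   Context: $\mathcal{S}$ denotes the set of infinite subsets of $\mathbb{Z}_{\geqslant 0}$. For $A\in\mathcal{S}$, $r(n;A)=r_1(n;A)$ is the indicator of $n\in A$; for $d\geqslant 2$, $r_d(n;A)=\sum_{k_1+\dots+k_d=n} r(k_1;A)\cdots r(k_d;A)$. For real $x\geqslant0$, $s(x;A)=s_1(x;A)=|A\cap[0,x]|$ and $s_d(x;A)=\sum_{0\leqslant n\leqslant x} r_d(n;A)$. A real function is asymptotically defined if it is defined on $[\alpha,+\infty)$ for some $\alpha\geqslant 0$. A positive asymptotically defined measurable function $f$ is $O$-regularly varying if for every $\lambda>0$, $f(\lambda x)\asymp f(x)$ (i.e. $f(\lambda x)/f(x)$ is bounded above and below by positive constants for large $x$). A type-1 function is an asymptotically defined real function that is positive, monotonic and $O$-regularly varying. *)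

(* Defs.v *)
From HB Require Import structures.
From mathcomp Require Import all_boot all_order all_algebra finmap.
From mathcomp Require Import all_classical all_reals all_analysis.
Set Implicit Arguments.
Unset Strict Implicit.
Unset Printing Implicit Defensive.
Import Order.TTheory GRing.Theory Num.Theory.
Import numFieldNormedType.Exports.
Local Open Scope classical_set_scope.
Local Open Scope ring_scope.

Definition rep1 (A : set nat) (n : nat) : nat := n \in A.

(* Ordered d-tuples (k_1, ..., k_d) of naturals with sum n; each k_i is at
   most n, so the tuples range over 'I_n.+1. See repd1 for d = 1. *)
Definition repd (d : nat) (A : set nat) (n : nat) : nat :=
  (\sum_(k : {ffun 'I_d -> 'I_n.+1} | \sum_(i < d) k i == n)
     \prod_(i < d) rep1 A (k i))%N.

(* The condition n%:R <= x only matters for x < 0, where the sum is empty. *)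
Definition cntd (R : realType) (d : nat) (A : set nat) (x : R) : R :=
  (\sum_(n < (Num.truncn x).+1 | ((n%:R : R) <= x)%R) repd d A n)%N%:R.

Lemma repd1 (A : set nat) (n : nat) : repd 1 A n = rep1 A n.
Proof.
rewrite /repd (bigD1 [ffun=> ord_max]) /=; last by rewrite big_ord1 ffunE.
rewrite big_ord1 ffunE /= big1 ?addn0// => k /andP[].
rewrite big_ord1 => /eqP kn /negP[]; apply/eqP/ffunP => i.
by rewrite ffunE ord1; apply/val_inj.
Qed.

Lemma cntd1 (R : realType) (A : set nat) (x : R) :
  cntd 1 A x = #|` fset_set (A `&` [set n | n%:R <= x])|%:R.
Proof.
rewrite /cntd; congr (_%:R).
have sub : [set n | (n%:R : R) <= x] `<=` `I_(Num.truncn x).+1.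
  move=> m /= mx; have x0 : 0 <= x by apply: le_trans mx.
  by rewrite ltnS truncn_ge_nat.
have fin : finite_set (A `&` [set n | (n%:R : R) <= x]).
  by apply: sub_finite_set (finite_II (Num.truncn x).+1) => m [_ /sub].
under eq_bigr do rewrite repd1.
rewrite -(big_mkord (fun n => (n%:R : R) <= x) (rep1 A)).
rewrite (eq_bigr (fun n => if n \in A then 1 else 0)%N) => [|n _]; last first.
  by rewrite /rep1; case: (n \in A).
rewrite -big_mkcondr /= sum1_count -size_filter.
apply/perm_size/uniq_perm; rewrite ?filter_uniq ?iota_uniq ?fset_uniq// => n.
rewrite mem_filter mem_index_iota /= in_fset_set// in_setI andbC.
apply/idP/idP => [/and3P[_ nx nA]|/andP[nA]]; first by rewrite nA inE.
by rewrite inE => nx; apply/and3P; split => //; exact: sub.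
Qed.

(* The values of afun outside of adom are irrelevant. *)
Record asymp_fun (R : realType) := AsympFun {
  astart : R ;
  astart_ge0 : 0 <= astart ;
  afun :> R -> R }.

Definition adom (R : realType) (f : asymp_fun R) : set R :=
  [set` `[astart f, +oo[].

Definition positive_on (R : realType) (D : set R) (f : R -> R) :=
  forall x, D x -> 0 < f x.

Definition monotonic_on (R : realType) (D : set R) (f : R -> R) :=
  (forall x y, D x -> D y -> x <= y -> f x <= f y) \/
  (forall x y, D x -> D y -> x <= y -> f y <= f x).

Definition O_regularly_varying (R : realType) (f : asymp_fun R) :=
  [/\ positive_on (adom f) f, measurable_fun (adom f) f &
    forall lambda : R, 0 < lambda -> exists c C : R,
      [/\ 0 < c, 0 < C &
        \forall x \near +oo_R, c <= f (lambda * x) / f x <= C]].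

Definition type1 (R : realType) (f : asymp_fun R) :=
  [/\ positive_on (adom f) f, monotonic_on (adom f) f & O_regularly_varying f].

(* Difference quotients are taken inside D, so that the derivative at the
   endpoint of a half-line D is the one-sided one. *)
Definition diff_quot (R : realType) (f : R -> R) (x : R) : R -> R :=
  fun y => (f y - f x) / (y - x).

Definition derive_on (R : realType) (D : set R) (f : R -> R) (x : R) : R :=
  lim (diff_quot f x @ within D x^').

Definition C1_on (R : realType) (D : set R) (f : R -> R) :=
  (forall x, D x -> cvg (diff_quot f x @ within D x^')) /\
  {within D, continuous (derive_on D f)}.

Definition is_least (R : realType) (E : set R) (a : R) := E a /\ lbound E a.

(* The Landau notations expect a bundled filter. *)
Definition at_pinfty (R : realType) : filter_on R :=
  FilterType (pinfty_nbhs R) _.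

(* Main.v *)
Require Import Defs.
From HB Require Import structures.
From mathcomp Require Import all_boot all_order all_algebra finmap.
From mathcomp Require Import all_classical all_reals all_analysis.
From mathcomp Require Import measurable_realfun ring lra.
Import Order.TTheory GRing.Theory Num.Theory.
Import numFieldNormedType.Exports.
Local Open Scope classical_set_scope.
Local Open Scope ring_scope.

(** Write [r] for the [(d-1)]-fold representation function of [A] and [s] for
    the counting function of [A], so that [s_d(x) = sum_(b <= x) r(b) s(x - b)].
    Since [s_(d-1)] is a step function and [f'] is continuous, the fundamental
    theorem of calculus gives
      [int_alpha^(x-alpha) s_(d-1)(t) f'(x-t) dt
         = sum_(b <= x - alpha) r(b) (f(x - max(alpha,b)) - f(alpha))].
    The two sums agree term by term up to [r(b) O(eps(x))]:
    [f] is nondecreasing because [s] is unbounded; [eps] is bounded below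
    because [s] has jumps and [f] has none, hence [eps(y) = O(eps(x))] for
    [alpha <= y <= x]; and [f(x) - f(x - alpha) = O(eps(x))] because
    [s(x) - s(x - alpha) <= alpha + 1]. It remains to sum over [b], using
    [sum_(b <= x) r(b) <= s(x)^(d-1) = O(f(x)^(d-1))]. *)

(** * Representation functions as coefficients of powers of a generating polynomial, and their
    partial sums over the naturals *)

Lemma coef_expr_eq (S : nzSemiRingType) (p q : {poly S}) (n d : nat) :
  (forall i, (i <= n)%N -> p`_i = q`_i) ->
  forall i, (i <= n)%N -> (p ^+ d)`_i = (q ^+ d)`_i.
Proof.
move=> pq; elim: d => [|d IH] i ilen; first by rewrite !expr0.
rewrite !exprS !coefM; apply: eq_bigr => j _.
have jn : (j <= n)%N by rewrite (leq_trans _ ilen)// -ltnS.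
by rewrite pq// IH// (leq_trans (leq_subr _ _)).
Qed.

(** The generating series of [A] cut off after degree [N], so that its powers are ordinary
    polynomial powers. *)
Definition rep_poly (A : set nat) (N : nat) : {poly nat} :=
  \poly_(k < N.+1) rep1 A k.

(** Distributing the power over the sum gives a sum over the maps ['I_d -> 'I_n.+1] that index
    [repd]. The cut-off [N] is free because the coefficient of degree [n] only sees degrees up to
    [n]; this lets different [n] share one polynomial. *)
Lemma repd_coef (A : set nat) (d n N : nat) : (n <= N)%N ->
  repd d A n = (rep_poly A N ^+ d)`_n.
Proof.
move=> nN.
transitivity ((rep_poly A n ^+ d)`_n); last first.
  apply: (@coef_expr_eq _ _ _ n) => // i ilen.
  by rewrite !coef_poly !ltnS ilen (leq_trans ilen).
rewrite -[d in RHS]card_ord -prodr_const /rep_poly poly_def bigA_distr_bigA.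
rewrite coef_sum /=.
rewrite /repd big_mkcond /=; apply: eq_bigr => k _.
have -> : \prod_(i < d) (rep1 A (k i) *: 'X^(k i)) =
    (\prod_(i < d) rep1 A (k i))%N *: 'X^(\sum_(i < d) k i) :> {poly nat}.
  elim/big_ind3 : _ => //=; first by rewrite expr0 scale1r.
  move=> a u v b u' v' -> ->.
  by rewrite -scalerAl -scalerAr scalerA exprD.
rewrite coefZ coefXn eq_sym; case: eqP => _; first by rewrite mulr1.
by rewrite mulr0.
Qed.

Lemma repdS (A : set nat) (d n : nat) :
  repd d.+1 A n = (\sum_(j < n.+1) repd d A j * rep1 A (n - j))%N.
Proof.
rewrite (@repd_coef A d.+1 n n)// exprSr coefM; apply: eq_bigr => j _.
rewrite (@repd_coef A d j n); last by rewrite -ltnS.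
by rewrite coef_poly ltnS leq_subr.
Qed.

Definition cntN (d : nat) (A : set nat) (n : nat) : nat :=
  (\sum_(k < n.+1) repd d A k)%N.

Lemma cntN_homo (d : nat) (A : set nat) (m n : nat) :
  (m <= n)%N -> (cntN d A m <= cntN d A n)%N.
Proof.
move=> mn; rewrite /cntN -!(big_mkord xpredT (repd d A)).
by rewrite (@big_cat_nat _ _ _ m.+1 0 n.+1)//= leq_addr.
Qed.

(** Passing from [n] to [n.+1] raises each [cntN 1 A (n - b)] by [rep1 A (n.+1 - b)], and by [repdS]
    these increments, with the new term [b = n.+1], add up to [repd d.+1 A n.+1]. *)
Lemma cntNS (A : set nat) (d n : nat) :
  cntN d.+1 A n = (\sum_(b < n.+1) repd d A b * cntN 1 A (n - b))%N.
Proof.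
elim: n => [|n IH].
  by rewrite /cntN !big_ord1 repdS big_ord1 -repd1.
rewrite {1}/cntN big_ord_recr/= -/(cntN d.+1 A n) IH repdS.
rewrite [in RHS]big_ord_recr/= [X in (_ + X)%N = _]big_ord_recr/= subnn.
have -> : cntN 1 A 0 = rep1 A 0 by rewrite /cntN big_ord1 repd1.
rewrite addnA; congr (_ + _)%N.
rewrite -big_split; apply: eq_bigr => b _ /=.
rewrite -mulnDr subSn; last by rewrite -ltnS.
by rewrite {2}/cntN big_ord_recr/= repd1.
Qed.

(** In [cntNS] every factor [cntN 1 A (n - b)] is at most [cntN 1 A n]. *)
Lemma cntN_le_exp (A : set nat) (d n : nat) :
  (cntN d.+1 A n <= cntN 1 A n ^ d.+1)%N.
Proof.
elim: d => [|d IH]; first by rewrite expn1.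
rewrite cntNS expnSr (leq_trans _ (leq_mul IH (leqnn _)))//.
rewrite {2}/cntN big_distrl/=; apply: leq_sum => b _.
by rewrite leq_mul2l cntN_homo ?orbT// leq_subr.
Qed.

Lemma cntN1_sub (A : set nat) (m n : nat) : (m <= n)%N ->
  (cntN 1 A n <= cntN 1 A m + (n - m))%N.
Proof.
move=> /subnK <-; elim: (n - m)%N => [|k IH]; first by rewrite subnn addn0.
rewrite addSn {1}/cntN big_ord_recr/= -/(cntN 1 A (k + m)%N) repd1.
rewrite addnK in IH; rewrite -addSn addnK addnS -[X in (_ <= X)%N]addn1.
by rewrite leq_add// /rep1; case: (_ \in _).
Qed.

Lemma cntN1_unbounded (A : set nat) : infinite_set A ->
  forall M, exists n, (M <= cntN 1 A n)%N.
Proof.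
move=> hA; elim=> [|M [n Mn]]; first by exists 0%N.
have [a Aa na] : exists2 a, A a & (n < a)%N.
  apply: contrapT => H; apply: hA; apply: sub_finite_set (finite_II n.+1).
  move=> a Aa /=; rewrite ltnS leqNgt; apply/negP => na; apply: H.
  by exists a.
exists a; case: a Aa na => // a Aa na.
rewrite {1}/cntN big_ord_recr/= -/(cntN 1 A a) repd1 /rep1 mem_set//= addn1 ltnS.
by rewrite (leq_trans Mn)// cntN_homo.
Qed.

(** * Counting functions of a real variable *)

Lemma cntd_ge0E (R : realType) (d : nat) (A : set nat) (x : R) : 0 <= x ->
  cntd d A x = (cntN d A (Num.truncn x))%:R.
Proof.
move=> x0; rewrite /cntd /cntN; congr (_%:R); apply: eq_bigl => n.
by rewrite -truncn_ge_nat// -ltnS ltn_ord.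
Qed.

(** Moves the dependence on [x] from the range of summation into an indicator, so that one fixed
    finite sum serves for all points of an interval of integration. *)
Lemma cntd_wideE (R : realType) (d : nat) (A : set nat) (x : R) (N : nat) :
  (Num.truncn x <= N)%N ->
  cntd d A x = \sum_(b < N.+1) (repd d A b)%:R * (b%:R <= x)%R%:R.
Proof.
move=> xN; rewrite /cntd -(big_mkord (fun n => n%:R <= x) (repd d A)).
rewrite -(big_mkord xpredT (fun b => (repd d A b)%:R * (b%:R <= x)%R%:R)).
rewrite (@big_cat_nat _ _ _ (Num.truncn x).+1 0 N.+1)//=.
rewrite [X in _ = _ + X]big_nat_cond [X in _ = _ + X]big1 ?addr0; last first.
  move=> b /andP[/andP[xb _] _].
  case: leP => //= bx; last by rewrite mulr0.
  by move: xb; rewrite ltnNge truncn_ge_nat ?bx// (le_trans _ bx).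
rewrite natr_sum big_mkcond; apply: eq_bigr => b _.
by case: ifP => _; rewrite ?mulr1 ?mulr0.
Qed.

Lemma cntd_ge0 (R : realType) (d : nat) (A : set nat) (x : R) : 0 <= cntd d A x.
Proof. exact: ler0n. Qed.

Lemma cntd_homo (R : realType) (d : nat) (A : set nat) (x y : R) :
  0 <= x -> x <= y -> cntd d A x <= cntd d A y.
Proof.
move=> x0 xy; rewrite !cntd_ge0E ?(le_trans x0)// ler_nat.
by apply: cntN_homo; exact: le_truncn.
Qed.

Lemma cntdS (R : realType) (A : set nat) (d : nat) (x : R) : 0 <= x ->
  cntd d.+1 A x =
  \sum_(b < (Num.truncn x).+1) (repd d A b)%:R * cntd 1 A (x - b%:R).
Proof.
move=> x0; rewrite cntd_ge0E// cntNS natr_sum; apply: eq_bigr => b _.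
have bx : b%:R <= x by rewrite -truncn_ge_nat// -ltnS.
rewrite natrM cntd_ge0E ?subr_ge0//; congr (_ * (cntN 1 A _)%:R).
(* Subtracting the integer [b] commutes with taking the integer part. *)
symmetry; apply: truncn_def; have /andP[Nx xN] := truncn_itv x0.
have bN : (b <= Num.truncn x)%N by rewrite -ltnS.
rewrite -subSn// !natrB ?(leqW bN)// lerD2r ltrD2r Nx.
exact: xN.
Qed.

Lemma cntd_le_exp (R : realType) (A : set nat) (d : nat) (x : R) : 0 <= x ->
  cntd d.+1 A x <= cntd 1 A x ^+ d.+1.
Proof. by move=> x0; rewrite !cntd_ge0E// -natrX ler_nat cntN_le_exp. Qed.

Lemma cntd1_sub (R : realType) (A : set nat) (x a : R) : 0 <= a -> a <= x ->
  cntd 1 A x - cntd 1 A (x - a) <= a + 1.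
Proof.
move=> a0 ax; have x0 := le_trans a0 ax.
have xa0 : 0 <= x - a by rewrite subr_ge0.
have mn : (Num.truncn (x - a) <= Num.truncn x)%N by apply: le_truncn; lra.
rewrite !cntd_ge0E// lerBlDl.
have /le_trans : (cntN 1 A (Num.truncn x))%:R <=
    (cntN 1 A (Num.truncn (x - a)))%:R +
    ((Num.truncn x)%:R - (Num.truncn (x - a))%:R) :> R.
  by rewrite -natrB// -natrD ler_nat cntN1_sub.
apply; rewrite lerD2l; have /andP[h1 _] := truncn_itv x0.
have /andP[_] := truncn_itv xa0; rewrite -natr1.
by lra.
Qed.

Lemma cntd1_jump (R : realType) (A : set nat) (n : nat) (y : R) :
  A n -> 0 <= y < n%:R -> cntd 1 A y + 1 <= cntd 1 A (n%:R : R).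
Proof.
move=> An /andP[y0 yn]; rewrite !cntd_ge0E// natrK natr1 ler_nat.
have : (Num.truncn y < n)%N by rewrite truncn_lt_nat.
case: n An {yn} => // n An; rewrite ltnS => yn.
rewrite {2}/cntN big_ord_recr/= -/(cntN 1 A n) repd1 /rep1 mem_set//= addn1 ltnS.
exact: cntN_homo.
Qed.

(** * Calculus with derivatives relative to a domain, and integration of step functions *)

Section derive_on.
Context {R : realType}.
Implicit Types (D : set R) (f g : R -> R) (a b x y : R).

(** For [y != x], [f y] is [f x + diff_quot f x y * (y - x)], and the last product tends to [0]. *)
Lemma cvg_diff_quot_continuous D f x : cvg (diff_quot f x @ within D x^') ->
  f y @[y --> within D (nbhs x)] --> f x.
Proof.
move=> /cvg_ex[l fl].
have h0 : (y - x) @[y --> within D x^'] --> (0 : R).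
  rewrite -(subrr x); apply: cvgB; last exact: cvg_cst.
  apply: cvg_trans (cvg_within _) _ => //.
  by apply: cvg_trans (cvg_within _) _; exact: cvg_id.
have {fl}h : (f x + diff_quot f x y * (y - x)) @[y --> within D x^'] --> f x.
  rewrite -[X in _ --> X]addr0 -(mulr0 l).
  by apply: cvgD; [exact: cvg_cst|exact: cvgM].
apply/cvgrPdist_lt => e e0.
have /cvgrPdist_lt/(_ e e0) h1 := h.
have h2 : \forall y \near x, y != x -> D y ->
  `|f x - (f x + diff_quot f x y * (y - x))| < e by exact: h1.
suff : \forall y \near x, D y -> `|f x - f y| < e by [].
near=> y => Dy; have [->|yx] := eqVneq y x; first by rewrite subrr normr0.
have -> : f y = f x + diff_quot f x y * (y - x).
  by rewrite /diff_quot divfK ?subr_eq0// addrC subrK.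
by apply: (near h2 y).
Unshelve. all: by end_near. Qed.

Lemma C1_on_continuous D f : C1_on D f -> {within D, continuous f}.
Proof.
move=> [fD _]; apply/subspace_continuousP => x Dx.
exact/cvg_diff_quot_continuous/fD.
Qed.

Lemma is_derive_derive_on D f x : nbhs x D ->
  cvg (diff_quot f x @ within D x^') -> is_derive x 1 f (derive_on D f x).
Proof.
move=> nD fl.
suff dl : h^-1 *: ((f \o shift x) (h *: 1) - f x) @[h --> 0^'] --> derive_on D f x.
  split; first by apply/cvg_ex; exists (derive_on D f x).
  exact/cvg_lim.
apply/cvgrPdist_lt => e e0.
have /cvgrPdist_lt/(_ e e0) h1 := fl.
have h2 : \forall y \near x, y != x -> D y ->
  `|derive_on D f x - diff_quot f x y| < e by exact: h1.
have h3 : \forall y \near x, y != x -> `|derive_on D f x - diff_quot f x y| < e.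
  by near=> y => yx; apply: (near h2 y) => //; near: y.
move: h3; rewrite (near_shift 0 x)/= subr0 => h3.
suff : \forall h \near 0, h != 0 ->
  `|derive_on D f x - h^-1 *: ((f \o shift x) (h *: 1) - f x)| < e by [].
near=> h => h0.
have hx : h + x != x by rewrite -subr_eq0 addrK.
have : `|derive_on D f x - diff_quot f x (h + x)| < e by exact: (near h3 h).
by rewrite /diff_quot addrK /= -[h%:A]/(h * 1) mulr1 [_^-1 *: _]mulrC.
Unshelve. all: by end_near. Qed.

(** The limit is computed from the right, where the quotients are nonnegative; this side is
    available even at the endpoint [x = a]. *)
Lemma derive_on_ge0 a f x : a <= x ->
  (forall y z, a <= y -> a <= z -> y <= z -> f y <= f z) ->
  cvg (diff_quot f x @ within `[a, +oo[ x^') ->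
  0 <= derive_on `[a, +oo[ f x.
Proof.
move=> ax fnd fl.
have h : diff_quot f x y @[y --> x^'+] --> derive_on `[a, +oo[ f x.
  apply: cvg_trans fl; apply: cvg_app => P hP.
  have h2 : \forall y \near x, y != x -> y \in `[a, +oo[ -> P y by exact: hP.
  suff : \forall y \near x, x < y -> P y by [].
  near=> y => xy; apply: (near h2 y) => //; first by rewrite gt_eqF.
  by rewrite in_itv/= andbT (le_trans ax)// ltW.
apply: (cvgr_to_ge h); near=> y.
have xy : x < y by near: y; exact: nbhs_right_gt.
rewrite /diff_quot divr_ge0// subr_ge0 ?(ltW xy)//.
by rewrite fnd ?(ltW xy)// (le_trans ax)// ltW.
Unshelve. all: by end_near. Qed.

Lemma within_continuous_reflect D E g x : {within D, continuous g} ->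
  (forall t, E t -> D (x - t)) -> {within E, continuous (fun t => g (x - t))}.
Proof.
move=> /subspace_continuousP gD ED; apply/subspace_continuousP => t Et.
have /cvgrPdist_lt gt := gD _ (ED _ Et).
apply/cvgrPdist_lt => e e0.
have {}gt : \forall y \near x - t, D y -> `|g (x - t) - g y| < e by exact: gt.
have : (x - u) @[u --> t] --> x - t.
  by apply: cvgB; [exact: cvg_cst|exact: cvg_id].
move=> /(_ _ gt) h.
have gt' : \forall u \near t, D (x - u) -> `|g (x - t) - g (x - u)| < e by exact: h.
suff : \forall u \near t, E u -> `|g (x - t) - g (x - u)| < e by [].
by near=> u => Eu; apply: (near gt' u) => //; exact: ED.
Unshelve. all: by end_near. Qed.

(** The primitive is [t |-> - f (x - t)]. The degenerate interval [c = x - p] is treated apart, as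
    the fundamental theorem is applied with [c < x - p]. *)
Lemma FTC_reflect a f (p c : R) x : C1_on `[a, +oo[ f -> a <= p -> c <= x - p ->
  (\int[lebesgue_measure]_(t in `[c, (x - p)%R])
     (derive_on `[a, +oo[ f (x - t))%:E = (f (x - c) - f p)%:E)%E.
Proof.
move=> fC1 ap; rewrite le_eqVlt => /predU1P[->|cxp].
  by rewrite set_itv1 integral_set1 subKr subrr.
have sub t : [set` `[c, x - p]] t -> [set` `[a, +oo[] (x - t).
  by rewrite /= !in_itv/= andbT => /andP[_]; move: ap; lra.
have := @continuous_FTC2 R (fun t => derive_on `[a, +oo[ f (x - t))
  (fun t => - f (x - t)) c (x - p) cxp.
have df t : t \in `]c, x - p[ ->
    is_derive t 1 (fun t => - f (x - t)) (derive_on `[a, +oo[ f (x - t)).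
  rewrite in_itv/= => /andP[ct tp].
  have xt : a < x - t by move: ap; lra.
  have nD : nbhs (x - t) [set` `[a, +oo[].
    have : \forall y \near x - t, a < y by exact: lt_nbhsr.
    by apply: filterS => y; rewrite /= in_itv/= andbT => /ltW.
  have df : is_derive (x - t) 1 f (derive_on `[a, +oo[ f (x - t)).
    apply: is_derive_derive_on => //; apply: fC1.1.
    by rewrite /= in_itv/= andbT ltW.
  have dg : is_derive t 1 (fun t => x - t) (- 1).
    have := is_deriveB (is_derive_cst x t 1) (is_derive_id t (1 : R)).
    by rewrite sub0r.
  have := is_deriveN (@is_derive1_comp R f (fun t => x - t) t _ _ df dg).
  by rewrite mulrN1 opprK.
move=> -> //.
- by rewrite subKr -EFinB opprK addrC.
- by apply: (within_continuous_reflect _ _ _ _ _ sub); exact: fC1.2.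
- have cF : {within `[c, x - p], continuous (fun t => - f (x - t))}.
    have := within_continuous_reflect _ _ _ _ (C1_on_continuous _ _ fC1) sub.
    move=> /subspace_continuousP H; apply/subspace_continuousP => t /H.
    exact: cvgN.
  have [_ cl cr] := (continuous_within_itvP _ cxp).1 cF.
  by split => // t /df[].
- by move=> t /df h; rewrite derive1E derive_val.
Qed.

(** The indicator of [k%:R <= t] cuts the interval down to its part beyond [k]. Nonnegativity of [r]
    and [g] permits the exchange of sum and integral in the extended reals. *)
Lemma integral_step_sum (a b : R) g (N : nat) (r : nat -> R) :
  (forall k, 0 <= r k) -> measurable_fun `[a, b] g ->
  (forall t, a <= t <= b -> 0 <= g t) ->
  (\int[lebesgue_measure]_(t in `[a, b])
     ((\sum_(k < N) r k * (k%:R <= t)%R%:R) * g t)%:E =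
   \sum_(k < N) (r k)%:E *
     \int[lebesgue_measure]_(t in `[Num.max a k%:R, b]) (g t)%:E)%E.
Proof.
move=> r0 mg g0.
pose h (k : nat) : R -> \bar R := (EFin \o g) \_ [set` `[(k%:R : R), +oo[].
have mgk k : measurable_fun `[a, b] (h k).
  apply/(measurable_restrict (EFin \o g)) => //.
  apply: measurable_funS (_ : measurable_fun `[a, b] _) => //.
  exact/measurable_EFinP.
have gk0 k t : [set` `[a, b]] t -> (0 <= h k t)%E.
  by move=> /= tab; rewrite /h patchE; case: ifP => // _; rewrite lee_fin g0.
transitivity (\int[lebesgue_measure]_(t in `[a, b])
   (\sum_(k < N) (r k)%:E * h k t))%E.
  apply: eq_integral => t _; rewrite mulr_suml -sumEFin; apply: eq_bigr => k _.
  rewrite /h patchE mem_setE in_itv/= andbT; case: leP => _ /=.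
    by rewrite mulr1 EFinM.
  by rewrite mulr0 mul0r mule0.
rewrite ge0_integral_sum//.
- apply: eq_bigr => k _; rewrite ge0_integralZl_EFin//; [|exact: gk0|exact: mgk].
  rewrite -integral_mkcondr; congr ((r k)%:E * integral _ _ _)%E.
  apply/seteqP; split => t /=; rewrite !in_itv/= andbT ge_max.
    by move=> [/andP[-> ->] ->].
  by move=> /andP[/andP[-> ->] ->].
- by move=> k; apply: measurable_funeM; exact: mgk.
- by move=> k t tab; rewrite mule_ge0 ?lee_fin ?gk0.
Qed.

End derive_on.

(** * Consequences of the asymptotic formula: explicit constants, monotonicity of [f], lower bound
    for the error term *)

Lemma eqaddO_pinftyP (R : realType) (s f e : R -> R) :
  s = f +O_ (at_pinfty R) e <->
  exists C M : R, 0 < C /\ forall x, M <= x -> `|s x - f x| <= C * `|e x|.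
Proof.
split=> [/eqaddOP[k0 [_ H]]|[C [M [C0 H]]]].
  have /H[M [_ HM]] : k0 < Num.max k0 0 + 1 by rewrite ltr_pwDr// le_max lexx.
  (* The maximum with [0] makes the constant positive; [M + 1] turns the strict threshold into a
     weak one. *)
  exists (Num.max k0 0 + 1), (M + 1); split.
    by rewrite ltr_pwDr// le_max lexx orbT.
  by move=> x Mx; apply: HM; lra.
apply/eqaddOP; exists C; split; first exact: num_real.
move=> k Ck; exists M; split; first exact: num_real.
move=> x /ltW Mx; rewrite (le_trans (H x Mx))//.
by rewrite ler_wpM2r// ltW.
Qed.

Lemma cntd1_unbounded (R : realType) (A : set nat) (B : R) : infinite_set A ->
  exists n : nat, B < cntd 1 A (n%:R : R).
Proof.
move=> /cntN1_unbounded/(_ (Num.truncn (Num.max B 0)).+1)[n hn]; exists n.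
rewrite cntd_ge0E// natrK.
have m0 : 0 <= Num.max B 0 by rewrite le_max lexx orbT.
have /andP[_ h] := truncn_itv m0.
rewrite (@le_lt_trans _ _ (Num.max B 0)) ?le_max ?lexx//.
by rewrite (lt_le_trans h)// ler_nat.
Qed.

(** If [f] were nonincreasing, the counting function would stay below [(1 + C) * f a] for large
    arguments, whereas it is unbounded. *)
Lemma nondecreasing_counting (R : realType) (A : set nat) (f : R -> R)
    (a C M : R) : infinite_set A -> 0 <= C ->
  monotonic_on `[a, +oo[ f ->
  (forall x, M <= x -> `|cntd 1 A x - f x| <= C * f x) ->
  forall y z, a <= y -> a <= z -> y <= z -> f y <= f z.
Proof.
move=> hA C0 [fnd _|fni sf].
  by move=> y z ay az; apply: fnd; rewrite /= in_itv/= andbT.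
exfalso; have [n hn] := cntd1_unbounded R A ((1 + C) * f a) hA.
pose x := Num.max n%:R (Num.max a M).
have nx : n%:R <= x by rewrite le_max lexx.
have ax : a <= x by rewrite !le_max lexx orbT.
have Mx : M <= x by rewrite !le_max lexx !orbT.
have fxa : f x <= f a by apply: fni; rewrite //= in_itv/= andbT.
have := sf x Mx; rewrite ler_norml => /andP[_ h1].
have := cntd_homo R 1 A n%:R x (ler0n _ _) nx => h2.
have : (1 + C) * f x <= (1 + C) * f a by rewrite ler_wpM2l//; lra.
move: hn; lra.
Qed.

(* [f] is continuous whereas the counting function jumps by [1] at the points
   of [A], so the error term cannot tend to [0]. *)
Lemma error_term_lower (R : realType) (A : set nat) (f eps : R -> R)
    (a alpha C M : R) : infinite_set A -> 0 <= a -> a <= alpha -> 0 < C ->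
  {within `[a, +oo[, continuous f} ->
  monotonic_on `[alpha, +oo[ eps -> (forall x, alpha <= x -> 0 < eps x) ->
  (forall x, M <= x -> `|cntd 1 A x - f x| <= C * eps x) ->
  exists c K, [/\ 0 < c, 0 < K & forall y x, alpha <= y -> y <= x ->
    c <= eps x /\ eps y <= K * eps x].
Proof.
move=> hA a0 aalpha C0 cf meps eps0 hs.
have ea : 0 < eps alpha by exact: eps0.
have D x : alpha <= x -> [set` `[alpha, +oo[] x by rewrite /= in_itv/= andbT.
case: meps => [eps_nd|eni].
  exists (eps alpha), 1; split=> // y x hy yx; rewrite mul1r.
  have hx := le_trans hy yx.
  by split; apply: eps_nd => //; exact: D.
(* For [eps] nonincreasing, take [n] in [A] beyond [x] and [y < n] so close that [f n - f y < 1/2].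
   The jump gives [1 <= 1/2 + C * eps n + C * eps y <= 1/2 + 2 * C * eps x]. *)
suff low x : alpha <= x -> (4 * C)^-1 <= eps x.
  have C4 : 0 < 4 * C by lra.
  exists (4 * C)^-1, (eps alpha * (4 * C)); split.
  - by rewrite invr_gt0.
  - by rewrite mulr_gt0.
  - move=> y x hy yx; have hx := le_trans hy yx.
    split; first exact: low.
    rewrite -mulrA (le_trans (eni alpha y (D _ _) (D _ _) hy))//.
    apply: ler_peMr; first exact: ltW.
    by rewrite -ler_pdivrMl// mulr1 low.
move=> hx.
(* Beyond [B] both the estimate [hs] and the comparison with [eps x] apply. *)
pose B := Num.max x M + 1.
have [n An Bn] : exists2 n : nat, A n & B + 1 <= n%:R.
  apply: contrapT => H; apply: hA.
  apply: sub_finite_set (finite_II (Num.truncn (B + 1)).+1).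
  move=> m Am /=; rewrite ltnS leqNgt; apply/negP => mB; apply: H.
  exists m => //; have B0 : 0 <= B + 1.
    have xM : x <= Num.max x M by rewrite le_max lexx.
    by rewrite /B; lra.
  have /andP[_ /ltW h] := truncn_itv B0.
  by rewrite (le_trans h)// ler_nat.
have xB : x + 1 <= B by rewrite lerD2r le_max lexx.
have MB : M + 1 <= B by rewrite lerD2r le_max lexx orbT.
have an : [set` `[a, +oo[] n%:R by rewrite /= in_itv/= andbT; lra.
move/subspace_continuousP : cf => /(_ _ an) /cvgrPdist_lt /(_ (2^-1)) cf.
have {}cf : \forall y \near (n%:R : R), y \in `[a, +oo[ -> `|f n%:R - f y| < 2^-1.
  by apply: cf; lra.
have [y [yn yx ych]] : exists y, [/\ y < n%:R, B < y & `|f n%:R - f y| < 2^-1].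
  have : \forall y \near (n%:R)^'-, [/\ y < n%:R, B < y & `|f n%:R - f y| < 2^-1].
    near=> y.
    have yn : y < n%:R by near: y; exact: nbhs_left_lt.
    have yB : B < y by near: y; apply: nbhs_left_gt; lra.
    split => //.
    have ya : y \in `[a, +oo[ by rewrite in_itv/= andbT; lra.
    by move: ya; near: y; apply: filterS cf => y ? _.
  by move=> /filter_ex.
have y0 : 0 <= y by lra.
have := cntd1_jump _ A n y An; rewrite y0 yn => /(_ isT) jump.
have := hs n%:R; rewrite ler_norml => /(_ _)/andP[|_ h1]; first by lra.
have := hs y; rewrite ler_norml => /(_ _)/andP[|h2 _]; first by lra.
have h3 : eps n%:R <= eps y by apply: eni; [apply: D; lra|apply: D; lra|lra].
have h4 : eps y <= eps x by apply: eni; [apply: D; lra|apply: D; lra|lra].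
move: ych; rewrite ltr_norml => /andP[_ h5].
have h6 : C * eps n%:R <= C * eps x by rewrite ler_pM2l// (le_trans h3).
have h7 : C * eps y <= C * eps x by rewrite ler_pM2l.
rewrite -[X in X <= _]mulr1 ler_pdivrMl; last by lra.
lra.
Unshelve. all: by end_near. Qed.

(** * The integral as a sum over [b], and its comparison with the convolution *)

Lemma integral_cntd (R : realType) (A : set nat) (e : nat) (f : R -> R)
    (a alpha x : R) : 0 <= a -> a <= alpha -> alpha <= x - alpha ->
  C1_on `[a, +oo[ f ->
  (forall y z, a <= y -> a <= z -> y <= z -> f y <= f z) ->
  \int[lebesgue_measure]_(t in [set` `[alpha, x - alpha]])
    (cntd e A t * derive_on `[a, +oo[ f (x - t)) =
  \sum_(b < (Num.truncn x).+1) (repd e A b)%:R *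
    (if b%:R <= x - alpha then f (x - Num.max alpha b%:R) - f alpha else 0).
Proof.
move=> a0 aalpha xalpha fC1 fnd.
have sub t : [set` `[alpha, x - alpha]] t -> [set` `[a, +oo[] (x - t).
  by rewrite /= !in_itv/= andbT => /andP[_]; lra.
rewrite /Rintegral.
under eq_integral => t.
  rewrite inE/= in_itv/= => /andP[at_ tx].
  rewrite (@cntd_wideE R e A t (Num.truncn x)); last by apply: le_truncn; lra.
  over.
rewrite (@integral_step_sum R alpha (x - alpha)
  (fun t => derive_on `[a, +oo[ f (x - t)) _ (fun b => (repd e A b)%:R))//.
- transitivity (fine (\sum_(b < (Num.truncn x).+1) ((repd e A b)%:R *
    (if (b%:R <= x - alpha)%R then f (x - Num.max alpha b%:R) - f alpha
     else 0))%:E)%E).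
    congr fine; apply: eq_bigr => b _; rewrite EFinM; congr (_ * _)%E.
    case: leP => bx; first by rewrite FTC_reflect// ge_max xalpha.
    (* For [b > x - alpha] the interval of integration is empty, whence the value [0]. *)
    rewrite set_itv_ge ?integral_set0// bnd_simp -ltNge.
    by rewrite lt_max bx orbT.
  by rewrite sumEFin.
- apply: subspace_continuous_measurable_fun => //.
  by apply: (within_continuous_reflect _ _ _ _ _ sub); exact: fC1.2.
- move=> t tx; have : a <= x - t by move: (sub t tx); rewrite /= in_itv/= andbT.
  move=> axt; apply: derive_on_ge0 => //; apply: fC1.1; exact: sub.
Qed.

(** Below the threshold both functions are bounded by their values there, and any constant [B] is at
    most [B / c * eps x] because [eps] is at least [c]. *)
Lemma uniform_error (R : realType) (A : set nat) (f eps : R -> R)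
    (alpha C M c : R) : 0 <= alpha -> 0 < C -> 0 < c ->
  (forall y z, alpha <= y -> alpha <= z -> y <= z -> f y <= f z) ->
  (forall x, alpha <= x -> 0 < f x) ->
  (forall x, alpha <= x -> c <= eps x) ->
  (forall x, M <= x -> `|cntd 1 A x - f x| <= C * eps x) ->
  exists2 C1, 0 < C1 & forall x, alpha <= x -> `|cntd 1 A x - f x| <= C1 * eps x.
Proof.
move=> al0 C0 c0 fnd f0 ceps hs.
pose M1 := Num.max M alpha.
have MM1 : M <= M1 by rewrite le_max lexx.
have aM1 : alpha <= M1 by rewrite le_max lexx orbT.
pose B := cntd 1 A M1 + f M1.
have B0 : 0 < B by rewrite /B ltr_wpDl ?cntd_ge0 ?f0.
exists (C + B / c); first by rewrite addr_gt0// divr_gt0.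
move=> x ax; have ex : 0 < eps x by rewrite (lt_le_trans c0)// ceps.
have Bc : B <= B / c * eps x.
  by rewrite -mulrA ler_pMr// mulrC ler_pdivlMr// mul1r ceps.
rewrite mulrDl; have [M1x|xM1] := leP M1 x.
  by rewrite (le_trans (hs x _)) ?(le_trans MM1)// lerDl (le_trans (ltW B0)).
apply: (@le_trans _ _ B); last first.
  by rewrite (le_trans Bc)// lerDr mulr_ge0// ltW.
have sx : cntd 1 A x <= cntd 1 A M1.
  by apply: cntd_homo; [exact: le_trans ax|exact: ltW].
have fx : f x <= f M1 by apply: fnd => //; exact: ltW.
have s0 : 0 <= cntd 1 A x by exact: cntd_ge0.
have := f0 x ax.
by rewrite /B ler_norml => fx0; apply/andP; split; lra.
Qed.

(** The bound is uniform in [b]. Terms bounded independently of [x] are collected in [W] and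
    absorbed through [c <= eps x]; values of [eps] at earlier points cost a factor [K]. *)
Lemma convolution_term_bound (R : realType) (A : set nat) (f eps : R -> R)
    (alpha c K C x b : R) : 0 <= alpha -> 0 < c -> 0 < C ->
  (forall y z, alpha <= y -> alpha <= z -> y <= z -> f y <= f z) ->
  (forall x, alpha <= x -> 0 < f x) ->
  (forall x, alpha <= x -> 0 < eps x) ->
  (forall y x, alpha <= y -> y <= x -> c <= eps x /\ eps y <= K * eps x) ->
  (forall x, alpha <= x -> `|cntd 1 A x - f x| <= C * eps x) ->
  alpha <= x - alpha -> 0 <= b -> b <= x ->
  `|cntd 1 A (x - b) -
    (if b <= x - alpha then f (x - Num.max alpha b) - f alpha else 0)| <=
  ((cntd 1 A alpha + f alpha + alpha + 1) / c + C * (1 + 2 * K)) * eps x.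
Proof.
move=> al0 c0 C0 fnd f0 eps0 hK hs ax b0 bx.
have ax' : alpha <= x by lra.
set W := cntd 1 A alpha + f alpha + alpha + 1.
have s0 : 0 <= cntd 1 A alpha by exact: cntd_ge0.
have fa0 := f0 alpha (lexx _).
have W0 : 0 < W by rewrite /W; lra.
have Wc : W <= W / c * eps x.
  rewrite -mulrA ler_pMr// mulrC ler_pdivlMr// mul1r.
  by have [] := hK alpha x (lexx _) ax'.
have e1 : 0 < C * eps x by rewrite mulr_gt0// eps0.
have eK y : alpha <= y -> y <= x -> C * eps y <= C * (K * eps x).
  by move=> ay yx; rewrite ler_pM2l//; have [] := hK y x ay yx.
have e2 : 0 < C * (K * eps x).
  by rewrite (lt_le_trans _ (eK x ax' (lexx _))).
have -> : (W / c + C * (1 + 2 * K)) * eps x =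
    W / c * eps x + (C * eps x + 2 * (C * (K * eps x))) by ring.
set E := W / c * eps x in Wc *; set E1 := C * eps x in e1 *.
set E2 := C * (K * eps x) in eK e2 *.
(* For [b > x - alpha] there is no integral term, and [x - b < alpha] bounds the count by its value
   at [alpha]. *)
case: (leP b (x - alpha)) => [bxa|xab]; last first.
  rewrite subr0 ger0_norm ?cntd_ge0//.
  have : cntd 1 A (x - b) <= cntd 1 A alpha by apply: cntd_homo; lra.
  by move: Wc; rewrite /W; lra.
have xb1 : alpha <= x - b by lra.
have xb2 : x - b <= x by lra.
have := hs _ xb1; have := eK _ xb1 xb2; rewrite ler_norml => h1 /andP[h2 h3].
(* If [alpha <= b], the term [f (x - b)] is compared directly with the count, leaving only
   [f alpha]. *)
have [ab|ba] := leP alpha b.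
  by rewrite ler_norml; apply/andP; split; move: Wc; rewrite /W; lra.
(* If [b < alpha], the integral gives [f (x - alpha)] in place of [f (x - b)]. By monotonicity the
   gap is at most [f x - f (x - alpha)], which is compared with the count on an interval of length
   [alpha]. *)
have g1 : f (x - b) <= f x by apply: fnd.
have g2 : f (x - alpha) <= f (x - b) by apply: fnd => //; lra.
have g3 := cntd1_sub R A x alpha al0 ax'.
have := hs x ax'; rewrite -/E1 ler_norml => /andP[k1 k2].
have := hs _ ax; rewrite ler_norml => /andP[k3 k4].
have k5 : C * eps (x - alpha) <= E2 by apply: eK => //; lra.
by rewrite ler_norml; apply/andP; split; move: Wc; rewrite /W; lra.
Qed.

(** * Choice of the constants and summation over [b] *)

Theorem theorem2p6 (R : realType) (A : set nat) (f eps : asymp_fun R)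
    (alpha : R) (d : nat)
    (hA : infinite_set A)
    (hf1 : type1 f) (heps1 : type1 eps)
    (hfC1 : C1_on (adom f) f)
    (hs : (cntd 1 A : R -> R) = (f : R -> R) +O_ (at_pinfty R) (eps : R -> R))
    (heps : (eps : R -> R) =o_ (at_pinfty R) (f : R -> R))
    (halpha0 : 0 < alpha)
    (halpha : is_least
       [set a : R | [set` `[a, +oo[] `<=` adom f `&` adom eps] alpha)
    (hd : (2 <= d)%N) :
  (cntd d A : R -> R) =
    (fun x : R => \int[lebesgue_measure]_(t in [set` `[alpha, x - alpha]])
                    (cntd d.-1 A t * derive_on (adom f) f (x - t)))
    +O_ (at_pinfty R) (fun x : R => f x ^+ d.-1 * eps x).
Proof.
case: d hd => [//|[//|e]] _ /=.
have a0 := astart_ge0 f.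
have [af aeps] : astart f <= alpha /\ astart eps <= alpha.
  case: halpha => /(_ alpha) H _; have := H _; rewrite /= /adom /=.
  by rewrite !in_itv/= !andbT lexx => /(_ isT)[].
move: hf1 heps1 => [fpos fmon _] [epos emon _].
have Df x : astart f <= x -> adom f x by rewrite /adom/= in_itv/= andbT.
have De x : alpha <= x -> adom eps x.
  by rewrite /adom/= in_itv/= andbT; exact: le_trans.
have eps0 x : alpha <= x -> 0 < eps x by move=> /De/epos.
have f0 x : astart f <= x -> 0 < f x by move=> /Df/fpos.
have f0' x : alpha <= x -> 0 < f x by move=> ax; apply: f0; exact: le_trans ax.
move/eqaddO_pinftyP : hs => [C [M0 [C0 hs]]].
move/eqoP : heps => /(_ 1 ltr01)[M1 [_ hM1]].
pose M := Num.max alpha (Num.max M0 (M1 + 1)).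
have aM : alpha <= M by rewrite le_max lexx.
have M0M : M0 <= M by rewrite !le_max lexx orbT.
have M1M : M1 + 1 <= M by rewrite !le_max lexx !orbT.
have ef x : M <= x -> eps x <= f x.
  move=> Mx; have := hM1 x; rewrite mul1r !gtr0_norm; last 2 first.
  - by apply: f0'; exact: le_trans Mx.
  - by apply: eps0; exact: le_trans Mx.
  - by apply; lra.
have {}hs x : M <= x -> `|cntd 1 A x - f x| <= C * eps x.
  move=> Mx; have := hs x (le_trans M0M Mx).
  by rewrite (gtr0_norm (eps0 _ _))// (le_trans aM).
(* Monotonicity is obtained from [astart f] on, not just from [alpha], since [derive_on] is taken
   relative to the whole domain of [f]. *)
have fnd : forall y z, astart f <= y -> astart f <= z -> y <= z -> f y <= f z.
  apply: (nondecreasing_counting R A f (astart f) C M) => //; first exact: ltW.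
  by move=> x Mx; rewrite (le_trans (hs x Mx))// ler_pM2l// ef.
have fnd' y z : alpha <= y -> alpha <= z -> y <= z -> f y <= f z.
  by move=> ay az; apply: fnd; exact: le_trans af _.
have [c [K [c0 K0 hK]]] : exists c K, [/\ 0 < c, 0 < K &
    forall y x, alpha <= y -> y <= x -> c <= eps x /\ eps y <= K * eps x].
  apply: (error_term_lower R A f eps (astart f) alpha C M) => //.
    exact: C1_on_continuous.
  by case: emon => H; [left|right] => x y /= hx hy; apply: H; apply: De;
    move: hx hy; rewrite !in_itv/= !andbT.
have [C1 C10 hC1] : exists2 C1, 0 < C1 &
    forall x, alpha <= x -> `|cntd 1 A x - f x| <= C1 * eps x.
  apply: (uniform_error R A f eps alpha C M c) => //; first exact: ltW.
  by move=> x ax; have [] := hK x x ax (lexx _).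
pose C2 := (cntd 1 A alpha + f alpha + alpha + 1) / c + C1 * (1 + 2 * K).
have C20 : 0 < C2.
  have s0 : 0 <= cntd 1 A alpha by exact: cntd_ge0.
  rewrite addr_gt0 ?divr_gt0 ?mulr_gt0//; last by lra.
  by have := f0' alpha (lexx _); lra.
(* Each [b] contributes an error [C2 * eps x], and the weights sum to at most
   [((1 + C) * f x) ^+ e.+1] since the count is at most [(1 + C) * f x]. The threshold [2 * alpha]
   ensures [alpha <= x - alpha]. *)
apply/eqaddO_pinftyP; exists ((1 + C) ^+ e.+1 * C2), (Num.max M (2 * alpha)).
split=> [|x]; first by rewrite mulr_gt0// exprn_gt0//; lra.
rewrite ge_max => /andP[Mx xa].
have x0 : 0 <= x by lra.
have ax : alpha <= x by lra.
have fx0 := f0' x ax; have ex0 := eps0 x ax.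
rewrite integral_cntd//; last by lra.
rewrite cntdS// -sumrB; under eq_bigr do rewrite -mulrBr.
rewrite (le_trans (ler_norm_sum _ _ _))//.
apply: (@le_trans _ _
  (\sum_(b < (Num.truncn x).+1) (repd e.+1 A b)%:R * (C2 * eps x))).
  apply: ler_sum => b _; rewrite normrM ger0_norm// ler_wpM2l//.
  apply: (convolution_term_bound R A f eps alpha c K C1 x b%:R) => //.
  - exact: ltW.
  - by lra.
  - by rewrite -truncn_ge_nat// -ltnS.
rewrite -mulr_suml -natr_sum -[X in X%:R]/(cntN e.+1 A _) -cntd_ge0E//.
rewrite (gtr0_norm (mulr_gt0 (exprn_gt0 _ fx0) ex0)).
have -> : (1 + C) ^+ e.+1 * C2 * (f x ^+ e.+1 * eps x) =
    ((1 + C) * f x) ^+ e.+1 * (C2 * eps x) by rewrite exprMn; ring.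
rewrite ler_pM2r ?mulr_gt0// (le_trans (cntd_le_exp _ _ _ _ x0))//.
apply: lerXn2r; rewrite ?nnegrE ?cntd_ge0//.
  by rewrite mulr_ge0 ?(ltW fx0)//; lra.
have := hs x Mx; rewrite ler_norml => /andP[_ h].
have : C * eps x <= C * f x by rewrite ler_pM2l// ef.
lra.
Qed.
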